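(* Let $k$ be an algebraically closed field of characteristic zero, and let $X \subseteq \mathbb{A}^{rs}$ be the variety of $r \times s$ matrices over $k$ of rank at most one. Assume $r > s \geq 3$. Then for every integer $m \geq 0$, the jet scheme $\mathcal{J}_m(X)$ has precisely $\lfloor \frac{m+1}{2} \rfloor + 1$ irreducible components, and these components have dimensions $qrs + (m+1-2q)\dim X$, where $q = 0, \ldots, \lfloor \frac{m+1}{2} \rfloor$ (one component for each value of $q$). In particular, $$\dim \mathcal{J}_m(X) = \left\lfloor \tfrac{m+1}{2} \right\rfloor rs + \big((m+1) \bmod 2\big)\dim X.$$
   Context: $X$ is the closed subscheme of $\mathbb{A}^{rs} = \operatorname{Spec} k[x_{ij} : 1\le i\le r, 1\le j\le s]$ defined by the ideal generated by all $2\times 2$ subdeterminants of the generic matrix $(x_{ij})$. For a scheme $X$ of finite type over $k$, the $m$-th jet scheme $\mathcal{J}_m(X)$ is the scheme parametrizing $k$-morphisms $\operatorname{Spec} k[t]/(t^{m+1}) \to X$. Concretely, for $X$ the closed subscheme of $\mathbb{A}^{rs}$ defined by the ideal generated by all $2\times 2$ subdeterminants of the generic $r \times s$ matrix $(x_{ij})$, $\mathcal{J}_m(X)$ is the closed subscheme of $\operatorname{Spec} k[x_{ij}^{(l)} : 1\le i\le r, 1\le j\le s, 0\le l\le m]$ defined by the ideal generated by the coefficients of $t^0, t^1, \ldots, t^m$ in all $2\times 2$ subdeterminants of the matrix with entries $x_{ij}^{(0)} + x_{ij}^{(1)}t + \cdots + x_{ij}^{(m)}t^m$. Here $(m+1)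 \bmod 2 \in \{0,1\}$ denotes the remainder of $m+1$ on division by $2$. *)

(* Defs.v *)
From HB Require Import structures.
From mathcomp Require Import all_boot all_order all_algebra.
From mathcomp Require Import ring_quotient.
From mathcomp Require Import all_classical topology.
From mathcomp Require Import mpoly.

Set Implicit Arguments.
Unset Strict Implicit.
Unset Printing Implicit Defensive.

Import Order.TTheory GRing.Theory.
Local Open Scope classical_set_scope.
Local Open Scope ring_scope.

Section Topology.
Variable T : topologicalType.
Implicit Type A : set T.

Definition closed_in A (Z : set T) := exists2 F, closed F & Z = A `&` F.

Definition irreducible A :=
  A !=set0 /\
  forall F G, closed F -> closed G -> A `<=` F `|` G -> A `<=` F \/ A `<=` G.

Definition irreducible_components A : set (set T) :=
  [set Z | [/\ Z `<=` A, irreducible Z &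
    forall Y, Y `<=` A -> irreducible Y -> Z `<=` Y -> Y = Z]].

(* A chain Z 0 < ... < Z n has length n; the values Z i for i > n are junk. *)
Definition irreducible_chain A (n : nat) (Z : nat -> set T) :=
  (forall i, (i <= n)%N -> irreducible (Z i) /\ closed_in A (Z i)) /\
  (forall i, (i < n)%N -> Z i `<` Z i.+1).

(* The Krull dimension of the subspace A is d.  This is a relation because the
   dimension of an arbitrary space may be infinite, or undefined if empty. *)
Definition has_dim A (d : nat) :=
  (exists Z, irreducible_chain A d Z) /\
  (forall n Z, irreducible_chain A n Z -> (n <= d)%N).

Lemma has_dim_unique A d e : has_dim A d -> has_dim A e -> d = e.
Proof.
move=> [[Z Zd] led] [[Y Ye] lee].
by apply/eqP; rewrite eqn_leq (lee _ _ Zd) (led _ _ Ye).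
Qed.

End Topology.

Record spec (R : comNzRingType) := Spec {
  spec_pred :> {pred R};
  spec_idealr : idealr_closed spec_pred;
  spec_prime : prime_idealr_closed spec_pred }.

HB.instance Definition _ (R : comNzRingType) := gen_eqMixin (spec R).
HB.instance Definition _ (R : comNzRingType) := gen_choiceMixin (spec R).

Definition zero_locus (R : comNzRingType) (E : set R) : set (spec R) :=
  [set p | forall f, E f -> f \in spec_pred p].

Section Zariski.
Variable R : comNzRingType.
Implicit Types (E F : set R) (p : spec R).

Definition zariski_open (U : set (spec R)) := exists E, U = ~` zero_locus E.

Lemma zariski_openT : zariski_open setT.
Proof.
exists setT; rewrite -setC0; congr (~` _); apply/seteqP; split=> // p pT.
by have [_ /negP[]] := spec_idealr p; exact: pT.
Qed.

Lemma zariski_openI : setI_closed zariski_open.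
Proof.
move=> _ _ [E ->] [F ->].
exists [set h | exists f g, [/\ E f, F g & h = f * g]].
rewrite -setCU; congr (~` _); apply/seteqP; split=> p.
  have [_ _ pD] := spec_idealr p; have [p0 _ _] := spec_idealr p.
  have pM a u : u \in spec_pred p -> a * u \in spec_pred p.
    by move=> pu; rewrite -[a * u]addr0; apply: pD.
  move=> [pE|pF] _ [f [g [Ef Fg ->]]]; last exact/pM/pF.
  by rewrite mulrC; exact/pM/pE.
move=> pEF; apply: contrapT => /not_orP[/existsNP[f /not_implyP[Ef pf]]].
move=> /existsNP[g /not_implyP[Fg pg]].
by have /spec_prime/orP[] : f * g \in spec_pred p by apply: pEF; exists f, g.
Qed.

Lemma zariski_open_bigcup (I : Type) (U : I -> set (spec R)) :
  (forall i, zariski_open (U i)) -> zariski_open (\bigcup_i U i).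
Proof.
move=> /choice[E UE]; exists (\bigcup_i E i).
rewrite (eq_bigcupr (fun i _ => UE i)) -setC_bigcap; congr (~` _).
apply/seteqP; split=> p pE; first by move=> f [i _ Ef]; exact: (pE i).
by move=> i _ f Ef; apply: pE; exists i.
Qed.

HB.instance Definition _ := isOpenTopological.Build (spec R)
  zariski_openT zariski_openI zariski_open_bigcup.

Lemma closed_specE (Z : set (spec R)) :
  closed Z <-> exists E, Z = zero_locus E.
Proof.
rewrite -openC; split=> [[E ZE]|[E ->]]; last by exists E.
by exists E; rewrite -[Z]setCK ZE setCK.
Qed.

End Zariski.

Definition ideal_gen (R : comNzRingType) (E : set R) : set R :=
  [set x | exists n (a g : 'I_n -> R),
    (forall i, E (g i)) /\ x = \sum_(i < n) a i * g i].

Definition minors2 (R : comNzRingType) (r s : nat) (A : 'M[R]_(r, s)) : set R :=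
  [set d | exists (f : 'I_2 -> 'I_r) (g : 'I_2 -> 'I_s),
    [/\ {homo f : a b / (a < b)%N}, {homo g : a b / (a < b)%N} &
        d = \det (mxsub f g A)]].

(* The ring k[x_i : i in I] and its indeterminates, for a finite type I. *)
Notation polyring k I := {mpoly k[#|{: I}|]}.

Definition indet (k : fieldType) (I : finType) (i : I) : polyring k I :=
  'X_(enum_rank i).

Section Determinantal.
Variables (k : fieldType) (r s : nat).

Definition generic_mx : 'M[polyring k ('I_r * 'I_s)]_(r, s) :=
  \matrix_(i, j) indet k (i, j).

(* A closed subscheme of Spec R is represented by its underlying space, a closed
   subset of spec R; irreducible components and dimension only depend on it. *)
Definition rank1_variety : set (spec (polyring k ('I_r * 'I_s))) :=
  zero_locus (ideal_gen (minors2 generic_mx)).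

Section Jets.
Variable m : nat.

Definition jet_ring := polyring k ('I_r * 'I_s * 'I_m.+1).

Definition generic_jet_mx : 'M[{poly jet_ring}]_(r, s) :=
  \matrix_(i, j) \sum_(l < m.+1) (indet k (i, j, l))%:P * 'X^l.

Definition jet_equations : set jet_ring :=
  [set c | exists2 d, minors2 generic_jet_mx d &
    exists2 l, (l <= m)%N & c = d`_l].

Definition jet_scheme : set (spec jet_ring) :=
  zero_locus (ideal_gen jet_equations).

End Jets.
End Determinantal.

Arguments generic_mx : clear implicits.
Arguments rank1_variety : clear implicits.
Arguments jet_ring : clear implicits.
Arguments generic_jet_mx : clear implicits.
Arguments jet_equations : clear implicits.
Arguments jet_scheme : clear implicits.

(* Main.v *)
Require Import Defs.
From HB Require Import structures.
From mathcomp Require Import all_boot all_order all_algebra.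
From mathcomp Require Import ring_quotient fraction.
From mathcomp Require Import all_classical topology mpoly.
From mathcomp Require Import zify.

(** Put N = m + 1 and let L be a field. Write a jet of X over L as a matrix
    A(t) over L[t] modulo t^N whose 2 x 2 minors vanish modulo t^N. If
    A = t^q B with B(0) <> 0 and 2 q < N, then the minors of B vanish modulo
    t^(N - 2q). An entry of B is invertible there, so B is a product u v^T of a
    column and a row modulo t^(N - 2q), and A = t^q u v^T + t^(N - q) W. If q
    is larger, then A still has this form with q = floor (N / 2) and u = 0
    ([rank_one_jet_factor]). Conversely every matrix of this form is a jet
    ([param_jet_minor]).

    For q <= N / 2 let Z_q be the closure of the set of these matrices, that
    is, the zero locus of the kernel of the ring morphism phi_q that sends the
    coordinates of the jet space to the coefficients of
    t^q u v^T + t^(N - q) W with indeterminate u, v and W. As its target is a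
    domain, Z_q is irreducible. A prime of the jet ring is the kernel of the
    evaluation at a jet over its residue field, so the factorization over
    fields shows that the jet scheme is the union of the Z_q
    ([jet_scheme_cover]). The rank one variety X is the case N = 1, q = 0.

    Replacing u, v by v_0 u, v / v_0 one may assume v_0 = 1. The parametrization
    then has q r s + (N - 2q) (r + s - 1) parameters, and this number is the
    dimension of Z_q. The upper bound: going up a strict chain of n + 1
    irreducible closed sets one collects n polynomials that are algebraically
    independent on the largest of them ([chain_alg_indep]); their images under
    phi_q are algebraically independent, so that n is at most the number of
    parameters ([mpoly_dependent]). The lower bound: setting the parameters to
    zero one after the other, in a suitable order, gives a strict chain of
    irreducible closed subsets of Z_q ([ker_locus_chain]).

    Finally, there are no inclusions among the Z_q. If q < q' then the generic
    jet of Z_q has order q and does not lie in Z_q', all of whose jets are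
    divisible by t^q'. If q > q' then an inclusion of Z_q in Z_q' would
    therefore be strict and the dimension would drop; but the dimension of Z_q
    is at least that of Z_q', because r s >= 2 (r + s - 1) for r > s >= 3.
    Hence the Z_q are the irreducible components, and the one with
    q = floor (N / 2) has the largest dimension. *)

Set Implicit Arguments.
Unset Strict Implicit.
Unset Printing Implicit Defensive.

Import Order.TTheory GRing.Theory.
Local Open Scope classical_set_scope.
Local Open Scope ring_scope.

(** * Evaluation of polynomials *)

Section PolynomialEvaluation.
Variable k : fieldType.

Lemma mmap_uniq n (S : comNzRingType) (g : {rmorphism {mpoly k[n]} -> S}) f :
  g f = mmap (g \o @mpolyC n k) (fun i => g 'X_i) f.
Proof.
rewrite {1}(mpolyE f) rmorph_sum; apply: eq_bigr => m _.
rewrite -mul_mpolyC rmorphM /= mpolyXE_id rmorph_prod; congr (_ * _).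
by apply: eq_bigr => i _; rewrite rmorphXn.
Qed.

Lemma mmap_rmorph n (S T : comNzRingType) (kap : {rmorphism k -> S})
    (g : {rmorphism S -> T}) (x : 'I_n -> S) f :
  g (mmap kap x f) = mmap (g \o kap) (g \o x) f.
Proof.
rewrite rmorph_sum; apply: eq_bigr => m _; rewrite rmorphM rmorph_prod.
by congr (_ * _); apply: eq_bigr => i _; rewrite rmorphXn.
Qed.

Section Defs.
Variables (I : finType) (S : comNzRingType) (kap : {rmorphism k -> S}).
Variable x : I -> S.

Definition polyev (f : polyring k I) : S := mmap kap (x \o enum_val) f.

HB.instance Definition _ := GRing.RMorphism.copy polyev
  (mmap kap (x \o enum_val)).

Lemma polyevC c : polyev c%:MP = kap c.
Proof. exact: mmapC. Qed.

Lemma polyev_indet i : polyev (indet k i) = x i.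
Proof. by rewrite /polyev /indet mmapX mmap1U /= enum_rankK. Qed.

End Defs.

Lemma eq_polyev (I : finType) (S : comNzRingType)
    (kap kap' : {rmorphism k -> S}) (x y : I -> S) f :
  kap =1 kap' -> x =1 y -> polyev kap x f = polyev kap' y f.
Proof.
move=> eqk eqx; apply: eq_bigr => m _; rewrite eqk; congr (_ * _).
by apply: eq_bigr => i _; rewrite /= eqx.
Qed.

Lemma polyev_rmorph (I : finType) (S T : comNzRingType)
    (kap : {rmorphism k -> S}) (g : {rmorphism S -> T}) (x : I -> S) f :
  g (polyev kap x f) = polyev (g \o kap) (g \o x) f.
Proof. exact: mmap_rmorph. Qed.

Lemma polyev_uniq (I : finType) (S : comNzRingType)
    (g : {rmorphism polyring k I -> S}) f :
  g f = polyev (g \o @mpolyC _ k) (g \o @indet k I) f.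
Proof.
rewrite mmap_uniq /polyev; apply: eq_bigr => m _; congr (_ * _).
by apply: eq_bigr => i _; rewrite /= /indet enum_valK.
Qed.

End PolynomialEvaluation.

(** * Residue fields of primes *)

Section ResidueField.
Variables (R : comNzRingType) (p : spec R).

Definition residue_pred : {pred R} := spec_pred p.

HB.instance Definition _ := isIdealr.Build R residue_pred (spec_idealr p).
HB.instance Definition _ :=
  isPrimeIdealrClosed.Build R residue_pred (@spec_prime _ p).

Definition residue_domain := {ideal_quot residue_pred}.
HB.instance Definition _ := GRing.ComNzRing.on residue_domain.

(** The quotient by a prime ideal has no computable inverse, so units and their
    inverses are chosen classically. *)
Definition residue_inv (x : residue_domain) : residue_domain :=
  if pselect (exists y, y * x = 1) is left xU then projT1 (cid xU) else x.

Definition residue_unit : pred residue_domain :=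
  fun x => `[< exists y, y * x = 1 >].

Lemma residue_mulV : {in residue_unit, left_inverse 1 residue_inv *%R}.
Proof.
move=> x /asboolP xU; rewrite /residue_inv.
by case: pselect => // xU'; case: cid.
Qed.

Lemma residue_unitP x y : y * x = 1 -> residue_unit x.
Proof. by move=> yx1; apply/asboolP; exists y. Qed.

Lemma residue_inv_out : {in [predC residue_unit], residue_inv =1 id}.
Proof.
by move=> x /asboolPn xNU; rewrite /residue_inv; case: pselect.
Qed.

HB.instance Definition _ := GRing.ComNzRing_hasMulInverse.Build residue_domain
  residue_mulV residue_unitP residue_inv_out.

HB.instance Definition _ := GRing.ComUnitRing_isIntegral.Build residue_domain
  (@Quotient.rquot_IdomainAxiom _ residue_pred).

(** The passage from primes to points: membership in a prime becomes the
    vanishing of a polynomial at a point with coordinates in a field. *)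
Lemma residue_field : exists (L : fieldType) (rho : {rmorphism R -> L}),
  forall f, (f \in spec_pred p) = (rho f == 0).
Proof.
pose pi : {rmorphism R -> residue_domain} := \pi_({ideal_quot residue_pred})%qT.
exists {fraction residue_domain}, (@FracField.tofrac residue_domain \o pi).
move=> f /=.
rewrite tofrac_eq0 -[X in _ == X](rmorph0 pi).
by rewrite -Quotient.idealrBE subr0.
Qed.

End ResidueField.

(** * Vanishing ideals and algebraic independence along chains *)

Section VanishingIdeal.
Variable R : comNzRingType.
Implicit Types (Z : set (spec R)) (p : spec R).

(** The ideal I(Z). It is prime when Z is irreducible ([vanish_prime]), and
    larger for smaller Z. *)
Definition vanish Z : set R := [set f | forall p, Z p -> f \in spec_pred p].

Lemma specMD p a u v :
  u \in spec_pred p -> v \in spec_pred p -> a * u + v \in spec_pred p.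
Proof. by have [_ _] := spec_idealr p; apply. Qed.

Lemma vanish0 Z : vanish Z 0.
Proof. by move=> p _; have [] := spec_idealr p. Qed.

Lemma vanishMD Z a u v : vanish Z u -> vanish Z v -> vanish Z (a * u + v).
Proof. by move=> Zu Zv p Zp; apply: specMD; [exact: Zu | exact: Zv]. Qed.

Lemma vanishMDr Z a u v : vanish Z u -> vanish Z (a * u + v) -> vanish Z v.
Proof.
move=> Zu Zuv; have := vanishMD (- a) Zu Zuv.
by rewrite mulNr addKr.
Qed.

Lemma vanish_proper Z : irreducible Z -> ~ vanish Z 1.
Proof.
by move=> [[p Zp] _] /(_ p Zp); have [_ /negP] := spec_idealr p.
Qed.

Lemma closed_zero_locus (E : set R) : closed (zero_locus E).
Proof. by apply/closed_specE; exists E. Qed.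

Lemma vanish_prime Z f g : irreducible Z -> vanish Z (f * g) ->
  vanish Z f \/ vanish Z g.
Proof.
move=> [_ Zirr] Zfg.
have /Zirr : Z `<=` zero_locus [set f] `|` zero_locus [set g].
  move=> p Zp; have /spec_prime/orP[pf|pg] := Zfg p Zp.
    by left=> _ ->.
  by right=> _ ->.
move=> /(_ (@closed_zero_locus _) (@closed_zero_locus _))[] Zf; [left|right].
  by move=> p /Zf; exact.
by move=> p /Zf; exact.
Qed.

Lemma vanish_sub Y Z : Y `<=` Z -> vanish Z `<=` vanish Y.
Proof. by move=> YZ f Zf p /YZ; exact: Zf. Qed.

(** A closed subset is cut out by the polynomials that vanish on it. *)
Lemma vanish_separate A Y Z : closed_in A Z -> Y `<=` A -> ~ (Y `<=` Z) ->
  exists2 h, vanish Z h & ~ vanish Y h.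
Proof.
move=> [F /closed_specE[E ->] ZE] YA YZ; apply: contrapT => noh.
apply: YZ => p Yp; rewrite ZE; split; first exact: YA.
move=> f Ef; apply: contrapT => pf; apply: noh; exists f.
  by move=> q; rewrite ZE => -[_]; exact.
by move=> /(_ _ Yp).
Qed.

End VanishingIdeal.

Section AlgebraicIndependence.
Variables (k : fieldType) (R : comNzRingType) (kap : {rmorphism k -> R}).

(** For [I] a prime ideal, this is algebraic independence over k of the classes
    of the [f i] in the quotient by [I]. *)
Definition alg_indep (I : set R) n (f : 'I_n -> R) :=
  forall G, I (mmap kap f G) -> G = 0.

(** The indices are split in the same way as in [muni], so that evaluation at
    [extend_last f h] is evaluation at [f] of the coefficients of [muni G],
    followed by evaluation at [h]. *)
Definition extend_last n (f : 'I_n -> R) (h : R) (i : 'I_n.+1) : R :=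
  if fintype.split (cast_ord (esym (addn1 n)) i) is inl j then f j else h.

Lemma mmap_extend_last n (f : 'I_n -> R) h G :
  mmap kap (extend_last f h) G =
  horner_eval h (map_poly (mmap kap f) (muni G)).
Proof.
have := mmap_uniq (horner_eval h \o map_poly (mmap kap f) \o @muni n k) G.
move=> /= ->; apply: eq_bigr => m _ /=; congr (_ * _).
  by rewrite /muni mmapC /= map_polyC /= horner_evalE hornerC mmapC.
apply: eq_bigr => i _; congr (_ ^+ _).
rewrite /muni mmapX mmap1U /extend_last; case: fintype.split => j.
  by rewrite map_polyC /= horner_evalE hornerC mmapX mmap1U.
by rewrite map_polyX horner_evalE hornerX.
Qed.

Lemma muni_inj n : injective (@muni n k).
Proof.
pose inv : {poly {mpoly k[n]}} -> {mpoly k[n.+1]} :=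
  horner_eval 'X_ord_max \o map_poly (@mwiden n k).
apply: (can_inj (g := inv)) => G.
rewrite -[LHS]/((inv \o @muni n k) G) (mmap_uniq (inv \o @muni n k)).
transitivity (idfun G) => //; rewrite (mmap_uniq idfun).
apply: eq_bigr => m _ /=; congr (_ * _).
  by rewrite /inv /muni /= mmapC /= map_polyC /= horner_evalE hornerC mwidenC.
apply: eq_bigr => i _; congr (_ ^+ _).
rewrite /inv /= /muni mmapX mmap1U; case: fintype.splitP => j /= ij.
  rewrite map_polyC /= horner_evalE hornerC mwidenX mnmwiden1.
  by congr 'X__; apply/val_inj.
rewrite map_polyX horner_evalE hornerX; congr 'X__; apply/val_inj.
by rewrite /= ij ord1 addn0.
Qed.

(** Let a relation G (f, h) = 0 hold on Y, with [G] a polynomial in its last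
    variable. On Z, where h = 0, only the constant term of G remains, and it
    vanishes because f is independent on Z. So h divides G (f, h), and as h is
    not zero on the irreducible set Y, a relation of smaller degree in h holds
    on Y. *)
Lemma alg_indep_extend (Y Z : set (spec R)) n (f : 'I_n -> R) h :
  irreducible Y -> Z `<=` Y -> vanish Z h -> ~ vanish Y h ->
  alg_indep (vanish Z) f -> alg_indep (vanish Y) (extend_last f h).
Proof.
move=> Yirr ZY Zh Yh f_indep G; rewrite mmap_extend_last => YG.
apply: (@muni_inj n); rewrite [RHS]rmorph0; move: {G}(muni G) YG.
elim/poly_ind => [//|P c IH].
rewrite rmorphD rmorphM /= map_polyX map_polyC /= !horner_evalE.
rewrite hornerMXaddC => YPc.
have c0 : c = 0.
  by apply/f_indep/(vanishMDr Zh)/(vanish_sub ZY); exact: YPc.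
move: YPc; rewrite c0 rmorph0 addr0 => /(vanish_prime Yirr)[/IH->|//].
by rewrite mul0r add0r.
Qed.

Lemma alg_indep0 (Z : set (spec R)) (f : 'I_0 -> R) :
  irreducible Z -> alg_indep (vanish Z) f.
Proof.
move=> Zirr G; have -> : G = (G@_0)%:MP.
  apply/mpolyP => m; rewrite mcoeffC.
  have -> : m = 0%MM by apply/mnmP => -[].
  by rewrite eqxx mulr1.
rewrite mmapC; have [->|c0 Zc] := eqVneq (G@_0) 0; first by rewrite rmorph0.
case: (vanish_proper Zirr); rewrite -(rmorph1 kap) -(mulVf c0) rmorphM.
by rewrite -[_ * _]addr0; apply: vanishMD => //; exact: vanish0.
Qed.

(** Each step of the chain contributes a function that vanishes on the smaller
    set and not on the larger one. *)
Lemma chain_alg_indep (A : set (spec R)) n Z : irreducible_chain A n Z ->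
  exists f : 'I_n -> R, alg_indep (vanish (Z n)) f.
Proof.
elim: n => [|n IH] [Zirr Zlt].
  by exists (fun=> 0); apply: alg_indep0; have [] := Zirr 0.
have [|f f_indep] := IH.
  by split=> i ilen; [apply: Zirr | apply: Zlt]; exact: leqW.
have [Yirr [F _ YF]] := Zirr n.+1 (leqnn _).
have [_ Zcl] := Zirr n (leqnSn _).
have [ZY YZ] := Zlt n (ltnSn _).
have YA : Z n.+1 `<=` A by rewrite YF => p [].
have [h Zh Yh] := vanish_separate Zcl YA YZ.
by exists (extend_last f h); exact: alg_indep_extend Yirr ZY Zh Yh f_indep.
Qed.

End AlgebraicIndependence.

(** * Algebraic dependence by counting monomials *)

Section Counting.
Variables (k : fieldType) (n d : nat) (g : 'I_n -> {mpoly k[d]}).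

Definition box_mnm l D (e : {ffun 'I_l -> 'I_D}) : 'X_{1..l} :=
  [multinom (e i : nat) | i < l].

Lemma box_mnm_inj l D : injective (@box_mnm l D).
Proof.
move=> e e' /mnmP ee'; apply/ffunP => i; apply/val_inj.
by have := ee' i; rewrite !mnmE.
Qed.

Lemma msizeM_leS (p q : {mpoly k[d]}) a b : (msize p <= a.+1)%N ->
  (msize q <= b.+1)%N -> (msize (p * q) <= (a + b).+1)%N.
Proof.
have [->|p0 pa] := eqVneq p 0; first by rewrite mul0r msize0.
have [->|q0 qb] := eqVneq q 0; first by rewrite mulr0 msize0.
by rewrite msizeM // -subn1 leq_subLR add1n -addnS -addSn leq_add.
Qed.

Lemma msize_exp_le (p : {mpoly k[d]}) b e :
  (msize p <= b.+1)%N -> (msize (p ^+ e) <= (e * b).+1)%N.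
Proof.
move=> pb; elim: e => [|e IH]; first by rewrite expr0 msize1.
by rewrite exprS mulSn msizeM_leS.
Qed.

Lemma msize_prod_le l (p : 'I_l -> {mpoly k[d]}) b :
  (forall i, msize (p i) <= b.+1)%N ->
  (msize (\prod_(i < l) p i) <= (l * b).+1)%N.
Proof.
elim: l p => [|l IH] p pb; first by rewrite big_ord0 msize1.
by rewrite big_ord_recl mulSn msizeM_leS ?IH.
Qed.

(** Let b bound the degrees of the [g i]. The D ^ n monomials in the [g i] with
    exponents below D have degree at most n D b, so with C = n D b + 1 they lie
    in the span of the C ^ d monomials in d variables with exponents below C.
    As C <= D (n b + 1), this span is too small once D > (n b + 1) ^ d. *)
Lemma mpoly_dependent : (d < n)%N ->
  exists2 G : {mpoly k[n]}, G != 0 & mmap (@mpolyC d k) g G = 0.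
Proof.
move=> dn; pose b := (\max_i msize (g i))%N.
have gb i : (msize (g i) <= b.+1)%N by apply/leqW/leq_bigmax.
pose D := ((n * b).+1 ^ d).+1; pose C := (n * (D * b)).+1.
pose ER := {ffun 'I_n -> 'I_D}; pose EC := {ffun 'I_d -> 'I_C}.
(* The rows of A hold the coefficients of the monomials in the g i, so a vector
   in the left kernel of A is a relation between them. *)
pose A : 'M[k]_(#|{: ER}|, #|{: EC}|) := \matrix_(i, j)
  (mmap1 g (box_mnm (enum_val i)))@_(box_mnm (enum_val j)).
have CD : (#|{: EC}| < #|{: ER}|)%N.
  rewrite !card_ffun !card_ord (@leq_ltn_trans ((D * (n * b).+1) ^ d)) //.
    have CDc : (C <= D * (n * b).+1)%N.
      by rewrite /C mulnCA mulnS addnC -addn1 leq_add2l.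
    by elim: (d) => // l IH; rewrite !expnS leq_mul.
  rewrite expnMn (@leq_trans (D ^ d.+1)) //; last by rewrite leq_pexp2l.
  by rewrite expnSr ltn_pmul2l // expn_gt0.
have /rowV0Pn[v /sub_kermxP vA v0] : kermx A != 0.
  rewrite kermx_eq0 /row_free neq_ltn (leq_ltn_trans _ CD) //.
  exact: rank_leq_col.
pose G := \sum_i v 0 i *: 'X_[k, box_mnm (enum_val i)].
exists G.
  apply: contraNneq v0 => G0; apply/eqP/rowP => i; rewrite mxE.
  have := congr1 (mcoeff (box_mnm (enum_val i))) G0.
  rewrite mcoeff0 /G raddf_sum /= (bigD1 i) //= mcoeffZ mcoeffX eqxx mulr1.
  rewrite big1 ?addr0 // => j ji.
  rewrite mcoeffZ mcoeffX (inj_eq (@box_mnm_inj _ _)) (inj_eq enum_val_inj).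
  by rewrite (negPf ji) mulr0.
have -> : mmap (@mpolyC d k) g G =
    \sum_i v 0 i *: mmap1 g (box_mnm (enum_val i)).
  rewrite rmorph_sum; apply: eq_bigr => i _.
  by rewrite /= mmapZ mmapX mul_mpolyC.
apply/mpolyP => m; rewrite mcoeff0 raddf_sum /=.
(* Outside the box of exponents below C the coefficient is zero for degree
   reasons. *)
have [mC|] := boolP [forall i, m i < C]%N.
  pose e : EC := [ffun i => Ordinal (forallP mC i)].
  have -> : m = box_mnm (enum_val (enum_rank e)).
    by apply/mnmP => i; rewrite enum_rankK mnmE ffunE.
  have := vA => /matrixP/(_ 0 (enum_rank e)); rewrite !mxE => vAe.
  by rewrite -[RHS]vAe; apply: eq_bigr => i _; rewrite mcoeffZ mxE.
rewrite negb_forall => /existsP[i]; rewrite -leqNgt => Cm.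
rewrite big1 // => a _; rewrite mcoeffZ memN_msupp_eq0 ?mulr0 //.
apply: msize_mdeg_ge; apply: (@leq_trans C); last first.
  by apply: leq_trans Cm _; rewrite mdegE (bigD1 i) //= leq_addr.
apply: msize_prod_le => j; apply: leq_trans (msize_exp_le _ (gb j)) _.
by rewrite ltnS leq_mul2r mnmE ltnW ?orbT.
Qed.

End Counting.

(** * Dimension of parametrized loci *)

Section KernelLocus.
Variables (R : comNzRingType) (D : idomainType) (phi : {rmorphism R -> D}).

Definition ker_locus : set (spec R) := zero_locus [set f | phi f = 0].

Lemma kernel_idealr : idealr_closed [pred f | phi f == 0].
Proof.
split; rewrite ?inE ?rmorph0 ?rmorph1 ?oner_eq0 // => a u v.
by rewrite !inE => /eqP u0 /eqP v0; rewrite rmorphD rmorphM u0 v0 mulr0 addr0.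
Qed.

Lemma kernel_prime : prime_idealr_closed [pred f | phi f == 0].
Proof. by move=> u v; rewrite !inE rmorphM mulf_eq0. Qed.

(** The generic point of [ker_locus]: every closed set that contains it
    contains [ker_locus]. *)
Definition kernel_point : spec R := Spec kernel_idealr kernel_prime.

Lemma kernel_pointP f : (f \in spec_pred kernel_point) = (phi f == 0).
Proof. by []. Qed.

Lemma ker_locus_kernel_point : ker_locus kernel_point.
Proof. by move=> f f0; rewrite kernel_pointP f0. Qed.

Lemma ker_locus_irreducible : irreducible ker_locus.
Proof.
split; first by exists kernel_point; exact: ker_locus_kernel_point.
have sub E : zero_locus E kernel_point -> ker_locus `<=` zero_locus E.
  by move=> E0 p Kp f /E0; rewrite kernel_pointP => /eqP; exact: Kp.
move=> F G /closed_specE[E ->] /closed_specE[E' ->].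
by move=> /(_ _ ker_locus_kernel_point)[/sub|/sub]; [left | right].
Qed.

End KernelLocus.

Section DimensionUpperBound.
Variables (k : fieldType) (R : comNzRingType) (kap : {rmorphism k -> R}).
Variables (d : nat) (phi : {rmorphism R -> {mpoly k[d]}}).
Hypothesis phi_kap : forall c, phi (kap c) = c%:MP.

(** [A] may be larger than the locus, so that this also bounds chains in a union
    of such loci. *)
Lemma ker_locus_chain_le A n Z : irreducible_chain A n Z ->
  Z n `<=` ker_locus phi -> (n <= d)%N.
Proof.
move=> Zchain Zphi; rewrite leqNgt; apply/negP => dn.
have [f f_indep] := chain_alg_indep kap Zchain.
have [G /eqP G0 Gf] := mpoly_dependent (phi \o f) dn.
apply/G0/f_indep => p /Zphi; apply => /=.
rewrite mmap_rmorph -[RHS]Gf; apply: eq_bigr => m _.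
by rewrite /= phi_kap.
Qed.

End DimensionUpperBound.

Section ZeroingVariables.
Variables (k : fieldType) (J : finType).
Implicit Types S : seq J.

Definition zeroing S : polyring k J -> polyring k J :=
  polyev (@mpolyC _ k) (fun j => if j \in S then 0 else indet k j).

HB.instance Definition _ S := GRing.RMorphism.copy (zeroing S)
  (polyev (@mpolyC _ k) (fun j => if j \in S then 0 else indet k j)).

Lemma zeroing_indet S j :
  zeroing S (indet k j) = if j \in S then 0 else indet k j.
Proof. exact: polyev_indet. Qed.

Lemma zeroing_zeroing S S' f : {subset S <= S'} ->
  zeroing S' (zeroing S f) = zeroing S' f.
Proof.
move=> SS'; rewrite {2}/zeroing polyev_rmorph.
apply: eq_bigr => m _; congr (_ * _); first exact: polyevC.
apply: eq_bigr => i _ /=; congr (_ ^+ _).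
case: ifPn => [/SS'->|_]; first by rewrite rmorph0.
by rewrite zeroing_indet.
Qed.

Lemma indet_neq0 (j : J) : indet k j != 0.
Proof. by rewrite /indet -msize_poly_eq0 msizeX. Qed.

End ZeroingVariables.

Section DimensionLowerBound.
Variables (k : fieldType) (J : finType) (R : comNzRingType).
Variables (phi : {rmorphism R -> polyring k J}) (lvl : J -> nat).
(** Variables are to be zeroed by increasing level, in any order within a level.
    When the turn of [j] comes, [S] holds the variables already zeroed, and the
    function [h] must distinguish the loci before and after that step. *)
Hypothesis separated : forall j, exists h : R, forall S : seq J,
  (forall i, (lvl i < lvl j)%N -> i \in S) ->
  (forall i, i \in S -> (lvl i <= lvl j)%N) -> j \notin S ->
  zeroing S (phi h) != 0 /\ zeroing (j :: S) (phi h) = 0.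

Lemma ker_locus_chain :
  exists Z, irreducible_chain (ker_locus phi) #|{: J}| Z.
Proof.
pose js := sort (relpre lvl leq) (enum {: J}).
have js_size : size js = #|{: J}| by rewrite size_sort -cardE.
have mem_js j : j \in js by rewrite mem_sort mem_enum.
have js_uniq : uniq js by rewrite sort_uniq enum_uniq.
have js_pairwise : pairwise (relpre lvl leq) js.
  rewrite -sorted_pairwise; last by move=> a b c; exact: leq_trans.
  by apply: sort_sorted => a b; exact: leq_total.
(* A larger index stands for a larger set, with fewer variables zeroed. *)
pose Z i := ker_locus (zeroing (take (size js - i) js) \o phi).
have Zsub i : Z i `<=` ker_locus phi.
  by move=> p Zp f f0; apply: Zp => /=; rewrite f0 rmorph0.
suff : irreducible_chain (ker_locus phi) (size js) Z.
  by rewrite js_size; exists Z.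
split=> i iJ.
  split; first exact: ker_locus_irreducible.
  exists (Z i); first exact: closed_zero_locus.
  by rewrite setIidr.
pose l := (size js - i.+1)%N.
have ltlJ : (l < size js)%N by rewrite /l -subSn // subSS leq_subr.
have Sl : (size js - i)%N = l.+1 by rewrite /l subnSK.
have j0 : J by case: (js) ltlJ.
pose j := nth j0 js l.
have takeS : take l.+1 js = rcons (take l js) j.
  by rewrite (take_nth j0).
have js_cat : js = take l js ++ j :: drop l.+1 js.
  by rewrite -cat_rcons -takeS cat_take_drop.
have := js_pairwise; rewrite {1}js_cat pairwise_cat.
move=> /and3P[lo _ /= /andP[hi _]].
have loj x : x \in take l js -> (lvl x <= lvl j)%N.
  by move=> xl; have /allrelP/(_ x j xl) := lo; apply; rewrite mem_head.
have hij x : x \in drop l.+1 js -> (lvl j <= lvl x)%N.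
  by move=> xd; have /allP/(_ x xd) := hi.
have jl : j \notin take l js.
  have := js_uniq; rewrite {1}js_cat cat_uniq => /and3P[_ + _].
  by move=> /hasPn/(_ j (mem_head _ _)).
rewrite /Z Sl -/l takeS; split=> [p Zp f|].
  move=> /= f0; apply: Zp => /=.
  rewrite -(zeroing_zeroing (S := take l js)) ?f0 ?rmorph0 // => x xl.
  by rewrite mem_rcons inE xl orbT.
move=> /(_ _ (@ker_locus_kernel_point _ _ _)) Zl.
have [h /(_ (take l js))[||//|hl hj]] := separated j.
- move=> x xj; have := mem_js x; rewrite {1}js_cat mem_cat => /orP[//|].
  rewrite inE => /predU1P[xj'|/hij]; first by rewrite xj' ltnn in xj.
  by rewrite leqNgt xj.
- exact: loj.
suff : h \in spec_pred (kernel_point (zeroing (take l js) \o phi)).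
  by rewrite kernel_pointP /= (negPf hl).
apply: Zl => /=.
rewrite -(zeroing_zeroing (S := j :: take l js)) ?hj ?rmorph0 //.
by move=> x; rewrite mem_rcons.
Qed.

Variable kap : {rmorphism k -> R}.
Hypothesis phi_kap : forall c, phi (kap c) = c%:MP.

Theorem ker_locus_dim : has_dim (ker_locus phi) #|{: J}|.
Proof.
split=> [|n Z Zchain]; first exact: ker_locus_chain.
apply: (ker_locus_chain_le phi_kap Zchain).
by have [/(_ n (leqnn n))[_ [F _ ->]] _] := Zchain; exact: subIsetl.
Qed.

End DimensionLowerBound.

(** * Irreducible components of a finite union *)

Section FiniteCover.
Variables (T : topologicalType) (A : set T) (n : nat) (Z : nat -> set T).
Hypothesis coverA : A = [set x | exists2 q, (q <= n)%N & Z q x].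
Hypothesis Zclosed : forall q, (q <= n)%N -> closed (Z q).

Lemma cover_sub q : (q <= n)%N -> Z q `<=` A.
Proof. by move=> qn x Zx; rewrite coverA; exists q. Qed.

(** Irreducibility, applied repeatedly to a union of two closed sets. *)
Lemma irreducible_sub_piece Y : irreducible Y -> Y `<=` A ->
  exists2 q, (q <= n)%N & Y `<=` Z q.
Proof.
move=> Yirr; rewrite coverA.
suff /(_ n (leqnn n))[] : forall l, (l <= n)%N ->
    closed [set x | exists2 q, (q <= l)%N & Z q x] /\
    (Y `<=` [set x | exists2 q, (q <= l)%N & Z q x] ->
     exists2 q, (q <= l)%N & Y `<=` Z q) by [].
elim=> [|l IH] ln.
  have -> : [set x | exists2 q, (q <= 0)%N & Z q x] = Z 0.
    by apply/seteqP; split=> x => [[[|//] _]|Zx]; last exists 0.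
  by split; [exact: Zclosed | exists 0].
have [clU subU] := IH (ltnW ln).
have -> : [set x | exists2 q, (q <= l.+1)%N & Z q x] =
    [set x | exists2 q, (q <= l)%N & Z q x] `|` Z l.+1.
  apply/seteqP; split=> x.
    move=> [q]; rewrite leq_eqVlt => /predU1P[->|ql] Zx; first by right.
    by left; exists q.
  by move=> [[q ql Zx]|Zx]; [exists q => //; exact: leqW | exists l.+1].
have Zl := Zclosed ln; split; first exact: closedU.
move=> /(Yirr.2 _ _ clU Zl)[/subU[q ql]|]; last by exists l.+1.
by exists q => //; exact: leqW.
Qed.

Hypothesis Zirr : forall q, (q <= n)%N -> irreducible (Z q).
Hypothesis Zincomparable : forall q q', (q <= n)%N -> (q' <= n)%N ->
  Z q `<=` Z q' -> q = q'.

Lemma irreducible_components_cover :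
  set_bij [set q | (q <= n)%N] (irreducible_components A) Z.
Proof.
split=> [q qn|q q'|Y [YA Yirr Ymax]].
- split=> [||Y YA Yirr ZY]; [exact: cover_sub | exact: Zirr |].
  have [q' q'n YZ] := irreducible_sub_piece Yirr YA.
  have /(Zincomparable qn q'n) qq' := subset_trans ZY YZ.
  by apply/seteqP; split; rewrite // qq'.
- rewrite !inE => qn q'n ZZ.
  by apply: Zincomparable => //; rewrite ZZ.
- have [q qn YZ] := irreducible_sub_piece Yirr YA.
  by exists q => //; exact: Ymax (cover_sub qn) (Zirr qn) YZ.
Qed.

End FiniteCover.

Section DimensionDrop.
Variable T : topologicalType.

(** A longest chain in A can be prolonged by B. *)
Lemma has_dim_proper (A B : set T) d e : has_dim A d -> has_dim B e ->
  closed A -> A `<=` B -> irreducible B -> closed B -> ~ B `<=` A -> (d < e)%N.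
Proof.
move=> [[Z [Zirr Zlt]] _] [_ maxB] Acl AB Birr Bcl BA.
apply: (maxB _ (fun i => if (i <= d)%N then Z i else B)); split=> i.
  case: (leqP i d) => [id _|_ _].
    have [Zi [F Fcl ZF]] := Zirr i id; split=> //.
    exists (Z i); first by rewrite ZF; exact: closedI.
    by rewrite setIidr // ZF => x [/AB].
  by split=> //; exists B => //; rewrite setIid.
rewrite ltnS => id; rewrite id; have := id.
rewrite leq_eqVlt => /predU1P[->|ltid]; last by rewrite ltid; exact: Zlt.
rewrite ltnn; have [_ [F _ ->]] := Zirr d (leqnn d).
by split=> [x [Ax _]|BAF]; [exact: AB | apply: BA => x /BAF[]].
Qed.

End DimensionDrop.

(** * Matrices of truncated polynomials with vanishing minors *)

Section TruncatedPolynomials.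

(** This is the form of the entries of [generic_jet_mx]. *)
Definition opoly (S : nzRingType) M (f : 'I_M -> S) : {poly S} :=
  \sum_(l < M) (f l)%:P * 'X^l.

Lemma coef_opoly (S : nzRingType) M (f : 'I_M -> S) (l : 'I_M) :
  (opoly f)`_l = f l.
Proof.
rewrite coef_sum (bigD1 l) //= coefCM coefXn eqxx mulr1 big1 ?addr0 //.
move=> i; rewrite -val_eqE eq_sym => /negPf il.
by rewrite coefCM coefXn il mulr0.
Qed.

Lemma map_opoly (S T : nzRingType) (g : {rmorphism S -> T}) M (f : 'I_M -> S) :
  map_poly g (opoly f) = opoly (g \o f).
Proof.
rewrite rmorph_sum; apply: eq_bigr => l _.
by rewrite /= rmorphM /= map_polyC map_polyXn.
Qed.

Lemma opoly_take (S : nzRingType) M (p : {poly S}) :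
  opoly (fun l : 'I_M => p`_l) = take_poly M p.
Proof.
rewrite /take_poly poly_def; apply: eq_bigr => l _.
by rewrite mul_polyC.
Qed.

Lemma opoly0 (S : nzRingType) M (f : 'I_M -> S) :
  (forall l, f l = 0) -> opoly f = 0.
Proof. by move=> f0; apply: big1 => l _; rewrite f0 mul0r. Qed.

Lemma dropXn (S : nzRingType) M (p : {poly S}) :
  (forall l, (l < M)%N -> p`_l = 0) -> p = drop_poly M p * 'X^M.
Proof.
move=> p0; rewrite -[LHS](poly_take_drop M) -opoly_take opoly0 ?add0r //.
by move=> l; exact: p0.
Qed.

Lemma eq_opoly (S : nzRingType) M (f g : 'I_M -> S) :
  f =1 g -> opoly f = opoly g.
Proof. by move=> /funext->. Qed.

Lemma opoly1 (S : nzRingType) (f : 'I_1 -> S) : opoly f = (f ord0)%:P.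
Proof. by rewrite /opoly big_ord1 expr0 mulr1. Qed.

Lemma coef0_opoly_minor (S : comNzRingType) (a b c d : 'I_1 -> S) :
  (opoly a * opoly b - opoly c * opoly d)`_0 =
  a ord0 * b ord0 - c ord0 * d ord0.
Proof. by rewrite !opoly1 -!polyCM -polyCB coefC. Qed.

Lemma coef_mul_take (L : nzRingType) M (a b : {poly L}) l : (l < M)%N ->
  (take_poly M a * take_poly M b)`_l = (a * b)`_l.
Proof.
move=> lM; rewrite !coefM; apply: eq_bigr => i _.
rewrite !coef_take_poly !ifT //; first exact: leq_ltn_trans (leq_subr _ _) lM.
by apply: leq_ltn_trans lM; rewrite -ltnS.
Qed.

Lemma inv_mod_Xn (L : fieldType) M (p : {poly L}) : p`_0 != 0 ->
  exists w c, p * w = 1 + c * 'X^M.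
Proof.
move=> p0; have : coprimep p 'X^M.
  rewrite coprimep_sym coprimep_expl // coprimep_sym -['X]subr0.
  by rewrite coprimep_XsubC /root horner_coef0.
move=> /Bezout_eq1_coprimepP[[w c] /= wc]; exists w, (- c).
by rewrite -wc mulNr mulrC addrK.
Qed.

(** Let q be the order of A, and let A = t^q B with B i0 j0 invertible modulo
    t^(N - 2q), of inverse w. The minor of B on the rows i0, i and the columns
    j0, j gives B i j = (w B i j0) (B i0 j) modulo t^(N - 2q). If q is at least
    N - N / 2, then A is divisible by t^(N - N / 2) and belongs to the last
    family with u = v = 0. *)
Lemma rank_one_jet_factor (L : fieldType) r s N
    (A : 'I_r -> 'I_s -> {poly L}) :
  (forall i i' j j' l, (l < N)%N ->
     (A i j * A i' j' - A i j' * A i' j)`_l = 0) ->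
  exists q (u : 'I_r -> {poly L}) (v : 'I_s -> {poly L})
    (W : 'I_r -> 'I_s -> {poly L}),
    (2 * q <= N)%N /\
    forall i j, A i j = 'X^q * (u i * v j) + 'X^(N - q) * W i j.
Proof.
move=> minA; have half : (2 * (N %/ 2) <= N)%N by lia.
pose P l := [exists i, exists j, (A i j)`_l != 0].
have [|high] := pselect (exists l, (l < N - N %/ 2)%N && P l); last first.
  exists (N %/ 2)%N, (fun=> 0), (fun=> 0),
    (fun i j => drop_poly (N - N %/ 2) (A i j)).
  split; first exact: half.
  move=> i j; rewrite mul0r mulr0 add0r mulrC; apply: dropXn => l lN.
  apply/eqP/negPn/negP => Al; apply: high; exists l; rewrite lN.
  by apply/existsP; exists i; apply/existsP; exists j.
move=> exP.
have [q /andP[qN /existsP[i0 /existsP[j0 Aq]]] qmin] := ex_minnP exP.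
have qN2 : (2 * q <= N)%N by lia.
pose B i j := drop_poly q (A i j).
have AB i j : A i j = B i j * 'X^q.
  apply: dropXn => l lq; apply/eqP/negPn/negP => Al.
  suff /qmin : (l < N - N %/ 2)%N && P l by rewrite leqNgt lq.
  rewrite (ltn_trans lq) //=.
  by apply/existsP; exists i; apply/existsP; exists j.
have B0 : (B i0 j0)`_0 != 0 by rewrite coef_drop_poly.
have [w [c Bw]] := inv_mod_Xn (N - 2 * q) B0.
(* A minor of A is t^(2q) times the minor of B. *)
have minB i j : exists e,
    B i0 j0 * B i j - B i0 j * B i j0 = e * 'X^(N - 2 * q).
  pose M := A i0 j0 * A i j - A i0 j * A i j0.
  exists (drop_poly N M); apply: (@mulIf _ 'X^(2 * q)).
    by rewrite expf_neq0 // polyX_eq0.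
  rewrite -mulrA -exprD subnK // -dropXn; last by move=> l; exact: minA.
  by rewrite /M !AB mul2n -addnn exprD !(mulrACA _ 'X^q) -mulrBl.
pose e i j := projT1 (cid (minB i j)).
have eP i j : B i0 j0 * B i j - B i0 j * B i j0 = e i j * 'X^(N - 2 * q).
  exact: projT2 (cid (minB i j)).
exists q, (fun i => w * B i j0), (fun j => B i0 j),
  (fun i j => w * e i j - c * B i j); split=> // i j.
have -> : 'X^(N - q) = 'X^q * 'X^(N - 2 * q) :> {poly L}.
  by rewrite -exprD; congr 'X^_; lia.
rewrite -(mulrA 'X^q) -(mulrDr 'X^q) AB [LHS]mulrC; congr (_ * _).
apply: (addIr (c * 'X^(N - 2 * q) * B i j)).
rewrite -{1}[B i j]mul1r -mulrDl -Bw mulrAC.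
rewrite -(subrK (B i0 j * B i j0) (B i0 j0 * B i j)) eP mulrDl mulrBr.
rewrite [c * 'X^_]mulrC -['X^_ * c * _]mulrA -[RHS]addrA subrK addrC.
congr (_ + _); first by rewrite mulrC mulrA mulrC.
by rewrite [RHS]mulrC [w * _]mulrC mulrA.
Qed.

End TruncatedPolynomials.

(** * Minors of order two *)

Lemma det2 (R : comNzRingType) (A : 'M[R]_2) :
  \det A = A 0 0 * A 1 1 - A 0 1 * A 1 0.
Proof.
rewrite (expand_det_row _ 0) !big_ord_recl big_ord0 addr0 /cofactor !det_mx11.
rewrite !mxE /= expr0 mul1r expr1 mulN1r mulrN.
by congr (A _ _ * A _ _ - A _ _ * A _ _); apply/val_inj.
Qed.

Section Minors.
Variables (R : comNzRingType) (r s : nat) (A : 'M[R]_(r, s)).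

Definition minor2 i i' j j' := A i j * A i' j' - A i j' * A i' j.

Lemma minors2_minor2 d : minors2 A d -> exists i i' j j', d = minor2 i i' j j'.
Proof.
move=> [f [g [_ _ ->]]]; exists (f 0), (f 1), (g 0), (g 1).
by rewrite det2 !mxE.
Qed.

Lemma minor2_minors2 (i i' : 'I_r) (j j' : 'I_s) : (i < i')%N -> (j < j')%N ->
  minors2 A (minor2 i i' j j').
Proof.
have two l (a b : 'I_l) : (a < b)%N ->
    {homo (fun c : 'I_2 => if c == 0 then a else b) : c d / (c < d)%N}.
  by move=> ab [[|[|c]] //= ?] [[|[|d]] //= ?].
move=> ii' jj'; exists (fun c => if c == 0 then i else i').
exists (fun c => if c == 0 then j else j'); split; [exact: two|exact: two|].
by rewrite det2 !mxE.
Qed.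

(** [minors2] lists increasing rows and columns only; the other minors differ
    from these by a sign or are zero. *)
Lemma minor2_vanish (P : R -> Prop) : P 0 -> (forall d, P d -> P (- d)) ->
  (forall d, minors2 A d -> P d) -> forall i i' j j', P (minor2 i i' j j').
Proof.
move=> P0 PN PA i i' j j'.
have rows a b c d : P (minor2 a b c d) -> P (minor2 b a c d).
  by move=> /PN; rewrite /minor2 opprB [A b d * _]mulrC [A b c * _]mulrC.
have cols a b c d : P (minor2 a b c d) -> P (minor2 a b d c).
  by move=> /PN; rewrite /minor2 opprB.
have [ii'|i'i|/val_inj->] := ltngtP i i'; last first.
- by rewrite /minor2 mulrC subrr.
- have [jj'|j'j|/val_inj->] := ltngtP j j'; last by rewrite /minor2 subrr.
  + exact/rows/PA/minor2_minors2.
  + exact/rows/cols/PA/minor2_minors2.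
- have [jj'|j'j|/val_inj->] := ltngtP j j'; last by rewrite /minor2 subrr.
  + exact/PA/minor2_minors2.
  + exact/cols/PA/minor2_minors2.
Qed.

End Minors.

Lemma zero_locus_ideal_gen (R : comNzRingType) (E : set R) :
  zero_locus (ideal_gen E) = zero_locus E.
Proof.
apply/seteqP; split=> p pE f.
  move=> Ef; apply: pE; exists 1%N, (fun=> 1), (fun=> f); split=> //.
  by rewrite big_ord1 mul1r.
move=> [n [a [g [Eg ->]]]].
have [p0 _ _] := spec_idealr p.
elim/big_ind: _ => [//|x y px py|i _]; first by rewrite -[x]mul1r specMD.
by rewrite -[_ * _]addr0; apply: specMD => //; exact/pE/Eg.
Qed.

(** * The parametrized families of jets *)

Section JetFamily.
Variables (r s N q : nat).
Hypothesis qN : (2 * q <= N)%N.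
Let M := (N - 2 * q)%N.

(** In this order: the coefficients of u, those of v except for its first entry
    v_0 = 1, and those of W. *)
Definition jet_params : finType :=
  ('I_r.+1 * 'I_M + 'I_s * 'I_M + 'I_r.+1 * 'I_s.+1 * 'I_q)%type.

Lemma card_jet_params : #|{: jet_params}| =
  (q * (r.+1 * s.+1) + (N - 2 * q) * (r.+1 + s))%N.
Proof. by rewrite !card_sum !card_prod !card_ord -/M; lia. Qed.

Definition left_factor (S : comNzRingType) (y : jet_params -> S) i : {poly S} :=
  opoly (fun l => y (inl (inl (i, l)))).

Definition right_factor (S : comNzRingType) (y : jet_params -> S)
    (j : 'I_s.+1) : {poly S} :=
  if unlift ord0 j is Some j' then opoly (fun l => y (inl (inr (j', l)))) else 1.

Definition high_part (S : comNzRingType) (y : jet_params -> S) i j : {poly S} :=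
  opoly (fun l => y (inr (i, j, l))).

Definition jet_of (S : nzRingType) (u : 'I_r.+1 -> {poly S})
    (v : 'I_s.+1 -> {poly S}) (W : 'I_r.+1 -> 'I_s.+1 -> {poly S}) i j :=
  'X^q * (u i * v j) + 'X^(N - q) * W i j.

Definition jet_coord (S : nzRingType) (A : 'I_r.+1 -> 'I_s.+1 -> {poly S})
    (x : 'I_r.+1 * 'I_s.+1 * 'I_N) : S := (A x.1.1 x.1.2)`_x.2.

Definition param_jet (S : comNzRingType) (y : jet_params -> S) :=
  jet_of (left_factor y) (right_factor y) (high_part y).

Lemma map_jet_of (S T : comNzRingType) (g : {rmorphism S -> T}) u v W i j :
  map_poly g (jet_of u v W i j) =
  jet_of (map_poly g \o u) (map_poly g \o v) (fun i j => map_poly g (W i j)) i j.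
Proof. by rewrite rmorphD !rmorphM /= !map_polyXn. Qed.

Lemma map_param_jet (S T : comNzRingType) (g : {rmorphism S -> T}) y i j :
  map_poly g (param_jet y i j) = param_jet (g \o y) i j.
Proof.
rewrite map_jet_of /param_jet /jet_of /left_factor /right_factor /high_part.
rewrite /= !map_opoly; congr (_ * (_ * _) + _).
by case: unlift => [j'|]; rewrite ?rmorph1 ?map_opoly.
Qed.

Lemma jet_coord_map (S T : comNzRingType) (g : {rmorphism S -> T}) y x :
  g (jet_coord (param_jet y) x) = jet_coord (param_jet (g \o y)) x.
Proof. by rewrite /jet_coord -coef_map map_param_jet. Qed.

(** In degrees from q to N - q only the product u v^T is seen. *)
Lemma coef_jet_low (S : nzRingType) (u : 'I_r.+1 -> {poly S}) v W i j l :
  (l < M)%N -> (jet_of u v W i j)`_(q + l) = (u i * v j)`_l.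
Proof.
move=> lM; rewrite coefD !coefXnM; have -> : (q + l < q)%N = false by lia.
have -> : (q + l < N - q)%N by rewrite /M in lM; lia.
by rewrite addr0; congr (_`__); lia.
Qed.

Section Evaluation.
Variables (k : fieldType).
Local Notation X := ('I_r.+1 * 'I_s.+1 * 'I_N)%type.

(** The morphism phi_q, whose kernel defines Z_q. *)
Definition jet_param_morphism : polyring k X -> polyring k jet_params :=
  polyev (@mpolyC _ k) (jet_coord (param_jet (@indet k jet_params))).

HB.instance Definition _ := GRing.RMorphism.copy jet_param_morphism
  (polyev (@mpolyC _ k) (jet_coord (param_jet (@indet k jet_params)))).

Lemma jet_param_morphismC c : jet_param_morphism c%:MP = c%:MP.
Proof. exact: polyevC. Qed.

Lemma jet_param_morphism_indet x : jet_param_morphism (indet k x) =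
  jet_coord (param_jet (@indet k jet_params)) x.
Proof. exact: polyev_indet. Qed.

Lemma jet_param_morphismE (S : comNzRingType) (kap : {rmorphism k -> S}) y f :
  polyev kap y (jet_param_morphism f) =
  polyev kap (jet_coord (param_jet y)) f.
Proof.
rewrite /jet_param_morphism polyev_rmorph; apply: eq_polyev => [c|x].
  exact: polyevC.
rewrite /= jet_coord_map /jet_coord; congr (_`__).
rewrite /param_jet /jet_of /left_factor /right_factor /high_part /=.
have opoly_indet n (f1 : 'I_n -> jet_params) :
    opoly (fun l => polyev kap y (indet k (f1 l))) = opoly (y \o f1).
  by apply: eq_bigr => l _; rewrite polyev_indet.
by rewrite !opoly_indet; case: unlift => [j'|]; rewrite ?opoly_indet.
Qed.

(** Modulo t^M the product u v^T does not change when u is multiplied by v_0 and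
    v by an inverse w of v_0. What changes in degrees M and above is absorbed
    by W. *)
Lemma jet_param_normalize (L : fieldType) (u : 'I_r.+1 -> {poly L})
    (v : 'I_s.+1 -> {poly L}) W : (v ord0)`_0 != 0 ->
  exists y, jet_coord (jet_of u v W) =1 jet_coord (param_jet y).
Proof.
move=> /(inv_mod_Xn M)[w [c vw]].
pose u' i := take_poly M (u i * v ord0).
pose v' j := if unlift ord0 j is Some _ then take_poly M (w * v j) else 1.
pose y (a : jet_params) : L := match a with
  | inl (inl (i, l)) => (u i * v ord0)`_l
  | inl (inr (j, l)) => (w * v (lift ord0 j))`_l
  | inr (i, j, l) => (jet_of u v W i j - 'X^q * (u' i * v' j))`_(N - q + l)
  end.
have yu i : left_factor y i = u' i by rewrite /u' -opoly_take.
have yv j : right_factor y j = v' j.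
  rewrite /v' /right_factor; case: unliftP => [j' ->|//].
  by rewrite -opoly_take.
have uv i j l : (l < M)%N -> (u i * v j)`_l = (u' i * v' j)`_l.
  move=> lM; rewrite /u' /v'; case: unliftP => [j' ->|->].
    rewrite coef_mul_take // [w * _]mulrC mulrACA vw mulrDr mulr1 coefD mulrA.
    by rewrite coefMXn lM addr0.
  by rewrite mulr1 coef_take_poly lM.
exists y => -[[i j] l]; rewrite /jet_coord /=.
have [lN|Nl] := ltnP l (N - q).
  rewrite /param_jet /jet_of !coefD !coefXnM lN yu yv; case: ltnP => // ql.
  by rewrite uv //; move: lN qN ql; rewrite /M; lia.
have lq : (l - (N - q) < q)%N by have := ltn_ord l; lia.
rewrite /param_jet {2}/jet_of yu yv [RHS]coefD [X in _ + X]coefXnM.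
rewrite ltnNge Nl /= /high_part.
rewrite -[(l - (N - q))%N]/(nat_of_ord (Ordinal lq)) coef_opoly /= subnKC //.
by rewrite coefB addrC subrK.
Qed.

End Evaluation.
End JetFamily.

Section JetFamilyClosure.
Variables (r s N q : nat) (k : fieldType).
Hypothesis qN : (2 * q <= N)%N.
Local Notation phi := (@jet_param_morphism r s N q k).

(** A jet with v_0(0) = 0 is a limit of jets with v_0(0) <> 0: replace v_0 by
    v_0 + eps with eps an indeterminate. The normalization applies over the
    field L(eps), so f vanishes on the deformed jet, whose coordinates lie in
    L[eps]; now set eps = 0. *)
Lemma ker_jet_param_jet (L : fieldType) (kap : {rmorphism k -> L}) u v W f :
  phi f = 0 -> polyev kap (jet_coord (@jet_of r s N q L u v W)) f = 0.
Proof.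
(* Here eps is the indeterminate of the inner polynomial ring, and jets over
   L[eps] are polynomials with coefficients there. *)
move=> f0; pose v' j : {poly {poly L}} :=
  map_poly polyC (v j) + (if j == ord0 then 'X%:P else 0).
pose A := @jet_of r s N q {poly L} (fun i => map_poly polyC (u i)) v'
  (fun i j => map_poly polyC (W i j)).
pose frac : {rmorphism {poly L} -> {fraction {poly L}}} :=
  @FracField.tofrac {poly L}.
have v'0 : (map_poly frac (v' ord0))`_0 != 0.
  rewrite coef_map tofrac_eq0 coefD coef_map coefC /=.
  by rewrite addrC -size_poly_eq0 size_XaddC.
have Af : polyev (polyC \o kap) (jet_coord A) f = 0.
  apply/eqP; rewrite -tofrac_eq0 -[X in X == _]/(frac _) polyev_rmorph.
  have [y Ay] := jet_param_normalize qN
    (fun i => map_poly frac (map_poly polyC (u i)))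
    (v := map_poly frac \o v')
    (fun i j => map_poly frac (map_poly polyC (W i j))) v'0.
  have := jet_param_morphismE (frac \o (polyC \o kap)) y f.
  rewrite f0 rmorph0 => fy; rewrite [X in _ == X]fy.
  apply/eqP; apply: eq_polyev => // x.
  by rewrite -Ay /jet_coord /= -coef_map map_jet_of.
rewrite -(rmorph0 (horner_eval (0 : L))) -Af polyev_rmorph.
apply: eq_polyev => [c|x] /=; first by rewrite horner_evalE hornerC.
have hK p : map_poly (horner_eval (0 : L)) (map_poly polyC p) = p.
  rewrite -map_poly_comp map_poly_id // => c _ /=.
  by rewrite horner_evalE hornerC.
rewrite /jet_coord -coef_map map_jet_of /=; congr (_`__).
have eps0 : map_poly (horner_eval (0 : L))
    (if x.1.2 == ord0 then 'X%:P else 0) = 0.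
  case: eqP => _; last by rewrite rmorph0.
  by rewrite map_polyC /= horner_evalE hornerX.
by rewrite /jet_of /= !hK rmorphD /= hK eps0 addr0.
Qed.

(** With M = N - 2q the matrix is t^q (u v^T + t^M E) modulo t^N. Its minors are
    t^(2q) times minors that vanish modulo t^M, since those of u v^T are
    zero. *)
Lemma param_jet_minor (S : comNzRingType) (y : jet_params r s N q -> S)
    (i i' : 'I_r.+1) (j j' : 'I_s.+1) l : (l < N)%N ->
  let A i j := opoly (fun l : 'I_N => jet_coord (param_jet y) (i, j, l)) in
  (A i j * A i' j' - A i j' * A i' j)`_l = 0.
Proof.
move=> lN A; have NE : N = (q + (q + (N - 2 * q)))%N by lia.
have NqE : (N - q = q + (N - 2 * q))%N by lia.
have [E AE] : exists E : 'I_r.+1 -> 'I_s.+1 -> {poly S}, forall i j, A i j =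
    'X^q * (left_factor y i * right_factor y j + 'X^(N - 2 * q) * E i j).
  exists (fun i j => high_part y i j - 'X^q * drop_poly N (param_jet y i j)).
  move=> a b; rewrite /A (opoly_take N (param_jet y a b)).
  have := poly_take_drop N (param_jet y a b); set D := drop_poly _ _.
  move=> /(canRL (addrK _)) ->; rewrite {1}/param_jet /jet_of -addrA.
  rewrite mulrDr; congr (_ + _); rewrite NqE [X in D * 'X^X]NE !exprD.
  rewrite !mulrBr !mulrA; congr (_ - _).
  by rewrite -!mulrA [D * _]mulrC -!mulrA; congr (_ * _); exact: mulrCA.
have mulE (p p' x e e' : {poly S}) : (p + x * e) * (p' + x * e') =
    p * p' + x * (p * e' + e * (p' + x * e')).
  rewrite mulrDl [p * (_ + _)]mulrDr -addrA -[x * e * _]mulrA.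
  by rewrite [p * (x * _)]mulrCA -mulrDr.
have XX (a b : {poly S}) : 'X^q * a * ('X^q * b) = 'X^(q + q) * (a * b).
  by rewrite exprD mulrACA.
have uv :
    left_factor y i * right_factor y j' * (left_factor y i' * right_factor y j) =
    left_factor y i * right_factor y j * (left_factor y i' * right_factor y j').
  by rewrite mulrACA [X in _ * X]mulrC -mulrACA.
rewrite !AE !XX !mulE uv -mulrBr opprD addrACA subrr add0r -mulrBr mulrA -exprD.
by rewrite coefXnM -addnA -NE lN.
Qed.

End JetFamilyClosure.

Section JetFamilyGeometry.
Variables (r s N : nat) (k : fieldType).
Local Notation X := ('I_r.+1 * 'I_s.+1 * 'I_N)%type.
Local Notation phi q := (@jet_param_morphism r s N q k).

Lemma jet_in_piece (L : fieldType) (kap : {rmorphism k -> L}) (a : X -> L) :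
  (forall i i' j j' l, (l < N)%N ->
    let A i j := opoly (fun l => a (i, j, l)) in
    (A i j * A i' j' - A i j' * A i' j)`_l = 0) ->
  exists2 q, (q <= N %/ 2)%N &
    forall f, phi q f = 0 -> polyev kap a f = 0.
Proof.
move=> /rank_one_jet_factor[q [u [v [W [qN aE]]]]].
exists q => [|f f0]; first by lia.
rewrite -[RHS](ker_jet_param_jet qN kap u v W f0); apply: eq_polyev => // x.
by rewrite /jet_coord /jet_of -aE coef_opoly; case: x => -[].
Qed.

(** The v are zeroed first, by increasing degree, while u_0 is still generic:
    the coefficient of degree q + l in the first row of the jet is then u_0(0)
    times the coefficient of degree l of v. Next come the u, which can be read
    off the first column since v_0 = 1, and once u = 0 the coefficients of W are
    coordinates of the jet. *)
Definition param_level q (x : jet_params r s N q) : nat :=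
  match x with
  | inl (inr (_, l)) => l
  | inl (inl _) => N - 2 * q
  | inr _ => (N - 2 * q).+1
  end.

Variable q : nat.
Hypothesis qN : (2 * q <= N)%N.

Lemma zeroing_jet_indet (S : seq (jet_params r s N q)) x :
  zeroing S (phi q (indet k x)) = jet_coord (param_jet
    (fun a : jet_params r s N q => if a \in S then 0 else indet k a)) x.
Proof.
rewrite /zeroing jet_param_morphismE; exact: polyev_indet.
Qed.

Section Coordinates.
Variables (S : comNzRingType) (y : jet_params r s N q -> S).

Lemma jet_coord_left i (l : 'I_(N - 2 * q)) (ql : (q + l < N)%N) :
  jet_coord (param_jet y) (i, ord0, Ordinal ql) = y (inl (inl (i, l))).
Proof.
rewrite /jet_coord.
apply: etrans (coef_jet_low qN _ _ _ _ _ (ltn_ord l)) _ => //.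
by rewrite /right_factor unlift_none mulr1 coef_opoly.
Qed.

Lemma jet_coord_right j (l : 'I_(N - 2 * q)) (ql : (q + l < N)%N)
    (l0 : (0 < N - 2 * q)%N) :
  (forall l' : 'I_(N - 2 * q), (l' < l)%N -> y (inl (inr (j, l'))) = 0) ->
  jet_coord (param_jet y) (ord0, lift ord0 j, Ordinal ql) =
    y (inl (inl (ord0, Ordinal l0))) * y (inl (inr (j, l))).
Proof.
move=> y0; rewrite /jet_coord.
apply: etrans (coef_jet_low qN _ _ _ _ _ (ltn_ord l)) _ => //.
rewrite /right_factor liftK coefM big_ord_recl big1 ?addr0 => [|b _].
  rewrite subn0 coef_opoly; congr (_ * _).
  exact: (coef_opoly _ (Ordinal l0)).
have lt : (l - lift ord0 b < N - 2 * q)%N.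
  exact: leq_ltn_trans (leq_subr _ _) (ltn_ord l).
rewrite -[(l - lift ord0 b)%N]/(nat_of_ord (Ordinal lt)) coef_opoly y0 ?mulr0 //=.
by rewrite /bump /=; have := ltn_ord b; lia.
Qed.

Lemma jet_coord_high i j (l : 'I_q) (ql : (N - q + l < N)%N) :
  (forall a, y (inl (inl a)) = 0) ->
  jet_coord (param_jet y) (i, j, Ordinal ql) = y (inr (i, j, l)).
Proof.
move=> y0; rewrite /jet_coord /= /param_jet /jet_of /left_factor opoly0 //.
rewrite mul0r mulr0 add0r coefXnM ltnNge leq_addr /= addKn.
by rewrite /high_part coef_opoly.
Qed.

End Coordinates.

Lemma jet_params_separated (j : jet_params r s N q) :
  exists x : X, forall S : seq (jet_params r s N q),
  (forall i, (param_level i < param_level j)%N -> i \in S) ->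
  (forall i, i \in S -> (param_level i <= param_level j)%N) -> j \notin S ->
  zeroing S (phi q (indet k x)) != 0 /\
  zeroing (j :: S) (phi q (indet k x)) = 0.
Proof.
case: j => [[[i l]|[j l]]|[[i j] l]].
- have ql : (q + l < N)%N by have := ltn_ord l; lia.
  exists (i, ord0, Ordinal ql) => S _ _ lS.
  have E (T : seq (jet_params r s N q)) :
      zeroing T (phi q (indet k (i, ord0, Ordinal ql))) =
      if inl (inl (i, l)) \in T then 0 else indet k (inl (inl (i, l))).
    apply: etrans (zeroing_jet_indet T _) _.
    exact: jet_coord_left.
  by rewrite !E (negPf lS) mem_head; split; first exact: indet_neq0.
- have ql : (q + l < N)%N by have := ltn_ord l; lia.
  have l0 := leq_ltn_trans (leq0n l) (ltn_ord l).
  pose a0 : jet_params r s N q := inl (inl (ord0, Ordinal l0)).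
  exists (ord0, lift ord0 j, Ordinal ql) => S lo hi lS.
  have E (T : seq (jet_params r s N q)) :
      (forall l' : 'I_(N - 2 * q), (l' < l)%N ->
      inl (inr (j, l')) \in T) ->
      zeroing T (phi q (indet k (ord0, lift ord0 j, Ordinal ql))) =
      (if a0 \in T then 0 else indet k a0) *
      (if inl (inr (j, l)) \in T then 0 else indet k (inl (inr (j, l)))).
    move=> loT; apply: etrans (zeroing_jet_indet T _) _.
    by apply: jet_coord_right => l' ll'; rewrite loT.
  have loS (l' : 'I_(N - 2 * q)) : (l' < l)%N -> inl (inr (j, l')) \in S.
    by move=> ll'; rewrite lo.
  rewrite (E S loS) E => [|l' ll']; last by rewrite inE loS ?orbT.
  rewrite (negPf lS) mem_head mulr0; split=> //.
  apply: mulf_neq0; last exact: indet_neq0.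
  case: ifPn => [/hi /=|_]; last exact: indet_neq0.
  by have := ltn_ord l; lia.
- have ql : (N - q + l < N)%N by have := ltn_ord l; lia.
  exists (i, j, Ordinal ql) => S lo hi lS.
  have E (T : seq (jet_params r s N q)) : (forall a, inl (inl a) \in T) ->
      zeroing T (phi q (indet k (i, j, Ordinal ql))) =
      if inr (i, j, l) \in T then 0 else indet k (inr (i, j, l)).
    move=> loT; apply: etrans (zeroing_jet_indet T _) _.
    by apply: jet_coord_high => a; rewrite loT.
  have loS a : inl (inl a) \in S by rewrite lo //= ltnS.
  rewrite (E S loS) E => [|a]; last by rewrite inE loS orbT.
  by rewrite (negPf lS) mem_head; split; first exact: indet_neq0.
Qed.

Lemma jet_piece_dim :
  has_dim (ker_locus (phi q)) (q * (r.+1 * s.+1) + (N - 2 * q) * (r.+1 + s)).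
Proof.
rewrite -(card_jet_params _ _ qN).
apply: (ker_locus_dim (lvl := @param_level q) _ (kap := @mpolyC _ k)).
  by move=> j; have [x xP] := jet_params_separated j; exists (indet k x).
exact: jet_param_morphismC.
Qed.

End JetFamilyGeometry.

(** * The jet schemes and the rank one variety *)

Section JetScheme.
Variables (r s m : nat) (k : fieldType).
Local Notation phi q := (@jet_param_morphism r s m.+1 q k).
Local Notation jets := (generic_jet_mx k r.+1 s.+1 m).

Lemma coef_jet_minor (S : comNzRingType)
    (g : {rmorphism jet_ring k r.+1 s.+1 m -> S}) i i' j j' l :
  let A i j := opoly (fun l => g (indet k (i, j, l))) in
  g (minor2 jets i i' j j')`_l = (A i j * A i' j' - A i j' * A i' j)`_l.
Proof.
move=> A; rewrite -coef_map /minor2 rmorphB !rmorphM /=.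
have jetE a b : map_poly g (jets a b) = A a b by rewrite mxE map_opoly.
by rewrite !jetE.
Qed.

Lemma jet_scheme_cover : jet_scheme k r.+1 s.+1 m =
  [set p | exists2 q, (q <= m.+1 %/ 2)%N & ker_locus (phi q) p].
Proof.
rewrite /jet_scheme zero_locus_ideal_gen; apply/seteqP; split=> p.
  move=> pJ; have [L [rho rhoP]] := residue_field p.
  have [|q qm qker] := @jet_in_piece r s m.+1 k L (rho \o @mpolyC _ k)
      (rho \o @indet k _).
    move=> i i' j j' l lm A.
    apply: etrans (esym (coef_jet_minor rho i i' j j' l)) _.
    apply/eqP; rewrite -rhoP.
    apply: (@minor2_vanish _ _ _ jets (fun d => d`_l \in spec_pred p)).
    - by rewrite coef0; have [] := spec_idealr p.
    - move=> d pd; rewrite coefN -mulN1r -[_ * _]addr0 specMD //.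
      by have [] := spec_idealr p.
    - by move=> d Jd; apply: pJ; exists d => //; exists l.
  by exists q => // f /qker f0; rewrite rhoP polyev_uniq; apply/eqP.
move=> [q qm pq] _ [d /minors2_minor2[i [i' [j [j' ->]]]] [l lm ->]].
apply: pq => /=; apply: etrans (coef_jet_minor _ _ _ _ _ _) _ => /=.
have qN : (2 * q <= m.+1)%N by lia.
have jetE a b : opoly (fun l => phi q (indet k (a, b, l))) =
    opoly (fun l : 'I_m.+1 => jet_coord
      (param_jet (@indet k (jet_params r s m.+1 q))) (a, b, l)).
  by apply: eq_opoly => l'; exact: jet_param_morphism_indet.
by rewrite !jetE; exact: param_jet_minor.
Qed.

(** The coordinate of degree q of the upper left entry vanishes on Z_q', and is
    the variable u_0(0) on Z_q. *)
Lemma jet_piece_order q q' : (q' <= m.+1 %/ 2)%N -> (q < q')%N ->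
  ~ ker_locus (phi q) `<=` ker_locus (phi q').
Proof.
move=> q'N qq' /(_ _ (@ker_locus_kernel_point _ _ _)) sub.
have qN : (q < m.+1)%N by lia.
have l0 : (0 < m.+1 - 2 * q)%N by lia.
have x0 : phi q' (indet k (ord0, ord0, Ordinal qN)) = 0.
  rewrite jet_param_morphism_indet /jet_coord /= coefD !coefXnM qq' add0r.
  by have -> : (q < m.+1 - q')%N by lia.
have qN2 : (2 * q <= m.+1)%N by lia.
have ql : (q + Ordinal l0 < m.+1)%N by rewrite addn0.
have xq : phi q (indet k (ord0, ord0, Ordinal qN)) =
    indet k (inl (inl (ord0, Ordinal l0)) : jet_params r s m.+1 q).
  have -> : Ordinal qN = Ordinal ql by apply/val_inj; rewrite /= addn0.
  by apply: etrans (jet_param_morphism_indet _ _ _) _; exact: jet_coord_left.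
have := sub _ x0; rewrite kernel_pointP => /eqP/(etrans (esym xq))/eqP.
exact/negP/indet_neq0.
Qed.

(** For a > b >= 3 one has a b >= 2 (a + b - 1), with equality for a = 4 and
    b = 3; here a and b are the numbers of rows and columns. *)
Lemma jet_piece_dim_mono q q' : (2 <= s)%N -> (s < r)%N ->
  (q' <= q)%N -> (q <= m.+1 %/ 2)%N ->
  (q' * (r.+1 * s.+1) + (m.+1 - 2 * q') * (r.+1 + s) <=
   q * (r.+1 * s.+1) + (m.+1 - 2 * q) * (r.+1 + s))%N.
Proof.
move=> s2 sr q'q qm; have PS : (2 * (r.+1 + s) <= r.+1 * s.+1)%N by nia.
have -> : (m.+1 - 2 * q' = m.+1 - 2 * q + 2 * (q - q'))%N by lia.
have {2}-> : q = (q' + (q - q'))%N by lia.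
by have := leq_mul (leqnn (q - q')) PS; nia.
Qed.

Lemma jet_piece_incomparable q q' : (2 <= s)%N -> (s < r)%N ->
  (q <= m.+1 %/ 2)%N -> (q' <= m.+1 %/ 2)%N ->
  ker_locus (phi q) `<=` ker_locus (phi q') -> q = q'.
Proof.
move=> s2 sr qm q'm sub; have [qq'|q'q|//] := ltngtP q q'.
  by case: (jet_piece_order q'm qq' sub).
have qN : (2 * q <= m.+1)%N by lia.
have q'N : (2 * q' <= m.+1)%N by lia.
have := has_dim_proper (jet_piece_dim r s k qN) (jet_piece_dim r s k q'N)
  (@closed_zero_locus _ _) sub (@ker_locus_irreducible _ _ _)
  (@closed_zero_locus _ _) (jet_piece_order qm q'q).
by rewrite ltnNge jet_piece_dim_mono // ltnW.
Qed.

End JetScheme.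

Section RankOneVariety.
Variables (r s : nat) (k : fieldType).
Local Notation phi := (@jet_param_morphism r s 1 0 k).
Local Notation X := ('I_r.+1 * 'I_s.+1)%type.

(** Identifies X with its jet scheme of order 0. *)
Definition constant_jet : polyring k X -> jet_ring k r.+1 s.+1 0 :=
  polyev (@mpolyC _ k) (fun x : X => indet k (x, ord0)).

HB.instance Definition _ := GRing.RMorphism.copy constant_jet
  (polyev (@mpolyC _ k) (fun x : X => indet k (x, ord0))).

Lemma constant_jet_indet (x : X) : constant_jet (indet k x) = indet k (x, ord0).
Proof. exact: polyev_indet. Qed.

Lemma rank1_variety_ker :
  rank1_variety k r.+1 s.+1 = ker_locus (phi \o constant_jet).
Proof.
rewrite /rank1_variety zero_locus_ideal_gen; apply/seteqP; split=> p.
  move=> pX; have [L [rho rhoP]] := residue_field p.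
  have [|q qm qker] := @jet_in_piece r s 1 k L (rho \o @mpolyC _ k)
      (fun x => rho (indet k x.1)).
    move=> i i' j j' l l1 /=; rewrite !opoly1 -!polyCM -polyCB coefC.
    case: eqP => // _; rewrite -!rmorphM -rmorphB; apply/eqP; rewrite -rhoP.
    have := @minor2_vanish _ _ _ (generic_mx k r.+1 s.+1)
      (fun d => d \in spec_pred p) _ _ _ i i' j j'.
    rewrite /minor2 !mxE; apply.
    - by have [] := spec_idealr p.
    - move=> d pd; rewrite -mulN1r -[_ * _]addr0 specMD //.
      by have [] := spec_idealr p.
    - by move=> d /pX.
  have q0 : q = 0%N by lia.
  move: qker; rewrite q0 => qker f /qker f0; rewrite rhoP.
  move: f0; rewrite /constant_jet polyev_rmorph => f0; apply/eqP.
  rewrite polyev_uniq -f0; apply: eq_polyev => [c|x] /=.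
    by rewrite [RHS]polyevC.
  by rewrite polyev_indet.
move=> pX _ /minors2_minor2[i [i' [j [j' ->]]]].
suff : (phi \o constant_jet) (minor2 (generic_mx k r.+1 s.+1) i i' j j') = 0.
  exact: pX.
have minor0 := etrans (esym (coef0_opoly_minor _ _ _ _))
  (@param_jet_minor r s 1 0 isT _ (@indet k (jet_params r s 1 0))
     i i' j j' 0 isT).
have phiE (x : X) : (phi \o constant_jet) (indet k x) =
    jet_coord (param_jet (@indet k (jet_params r s 1 0))) (x, ord0).
  by rewrite /= constant_jet_indet; exact: jet_param_morphism_indet.
rewrite /minor2 !mxE rmorphB !rmorphM.
by move: minor0; rewrite -!phiE; exact.
Qed.

Lemma rank1_variety_dim : has_dim (rank1_variety k r.+1 s.+1) (r.+1 + s).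
Proof.
have -> : (r.+1 + s = #|{: jet_params r s 1 0}|)%N.
  by rewrite card_jet_params // mul0n mul1n.
rewrite rank1_variety_ker.
apply: (ker_locus_dim (lvl := @param_level r s 1 0) _ (kap := @mpolyC _ k)).
  move=> j; have [[x l] xP] := jet_params_separated k (isT : (2 * 0 <= 1)%N) j.
  exists (indet k x); move: xP; rewrite (ord1 l) => xP S lo hi jS.
  by rewrite /= constant_jet_indet; exact: xP.
by move=> c /=; rewrite [constant_jet _]polyevC jet_param_morphismC.
Qed.

End RankOneVariety.

Theorem theorem5p1 (k : closedFieldType) (r s m : nat) :
  [pchar k]%R =i pred0 -> (3 <= s)%N -> (s < r)%N ->
  exists2 dX : nat, has_dim (rank1_variety k r s) dX &
    (exists Z : nat -> set (spec (jet_ring k r s m)),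
       set_bij [set q | (q <= (m + 1) %/ 2)%N]
               (irreducible_components (jet_scheme k r s m)) Z /\
       forall q, (q <= (m + 1) %/ 2)%N ->
         has_dim (Z q) (q * (r * s) + (m + 1 - 2 * q) * dX)%N) /\
    has_dim (jet_scheme k r s m)
      (((m + 1) %/ 2) * (r * s) + ((m + 1) %% 2) * dX)%N.
Proof.
move=> _; case: r s => [|r] [|s] // s3 sr; rewrite addn1.
exists (r.+1 + s)%N; first exact: rank1_variety_dim.
pose Z q := ker_locus (@jet_param_morphism r s m.+1 q k).
have Zclosed q : (q <= m.+1 %/ 2)%N -> closed (Z q).
  by move=> _; exact: closed_zero_locus.
have Zdim q : (q <= m.+1 %/ 2)%N ->
    has_dim (Z q) (q * (r.+1 * s.+1) + (m.+1 - 2 * q) * (r.+1 + s))%N.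
  by move=> qm; apply: jet_piece_dim; lia.
have cover := jet_scheme_cover r s m k.
split.
  exists Z; split=> //; apply: (irreducible_components_cover cover Zclosed).
    by move=> q _; exact: ker_locus_irreducible.
  by move=> q q'; apply: jet_piece_incomparable; lia.
have top : (m.+1 %/ 2 <= m.+1 %/ 2)%N by [].
have -> : (m.+1 %% 2 = m.+1 - 2 * (m.+1 %/ 2))%N by lia.
have Zsub := cover_sub cover top.
split.
  have [[C [Cirr Clt]] _] := Zdim _ top; exists C; split=> // i id.
  have [Ci [F Fcl CE]] := Cirr i id; split=> //.
  exists (C i); first by rewrite CE; apply: closedI => //; exact: Zclosed.
  by rewrite setIidr // CE => x [/Zsub].
move=> n C Cchain; have [Cn [F _ CE]] := Cchain.1 n (leqnn n).
have CJ : C n `<=` jet_scheme k r.+1 s.+1 m by rewrite CE => x [].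
have [q qm Cq] := irreducible_sub_piece cover Zclosed Cn CJ.
have := ker_locus_chain_le (@jet_param_morphismC r s m.+1 q k) Cchain Cq.
rewrite card_jet_params; last by lia.
by move=> /leq_trans; apply; apply: jet_piece_dim_mono => //; lia.
Qed.
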